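(* Let $\alpha,\beta>\frac12$. Let $\hat g\in C^1([-1,1])$ with $\hat g(-1)=-1$, $\hat g(1)=1$ and $\hat g'>0$ a.e. on $[-1,1]$, and for every $N\ge1$ let $x_i=\hat g(-1+2i/N)$, $i=0,\dots,N$. Let $H_N\in\mathbb{R}^{N\times N}$ be the weighted Jacobi histopolation matrix on the nodes $x_0,\dots,x_N$ with respect to the basis $P^{(\alpha+1,\beta+1)}_{j-1}$, $j=1,\dots,N$ (see context). Then the sequence $\left\{\frac{H_N}{N}\right\}_N$ is zero-distributed, namely $$\left\{\frac{H_N}{N}\right\}_N\sim_{\mathrm{GLT}}0 .$$
   Context: For $\alpha,\beta>-1$, $\omega_{\alpha,\beta}(t)=(1-t)^\alpha(1+t)^\beta$ on $[-1,1]$, and $P_j^{(\alpha,\beta)}$ is the Jacobi polynomial of degree $j$, orthogonal on $[-1,1]$ with respect to $\omega_{\alpha,\beta}$, with the standard normalization $P_j^{(\alpha,\beta)}(1)=\frac{\Gamma(j+\alpha+1)}{\Gamma(j+1)\Gamma(\alpha+1)}$. With $s_i=[x_{i-1},x_i]$ and $h_i=x_i-x_{i-1}$, $$[H_N]_{i,j}=\frac1{h_i}\int_{s_i}P^{(\alpha+1,\beta+1)}_{j-1}(t)\,\omega_{\alpha,\beta}(t)\,dt,\quad i,j=1,\dots,N.$$ For a sequence of matrices $Z_N\in\mathbb{C}^{N\times N}$, $\{Z_N\}_N\sim_{\mathrm{GLT}}0$ (GLT sequence with symbol $0$) is equivalent to, and may be taken as defined by, $\{Z_N\}_N$ being zero-distributed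 ($\{Z_N\}_N\sim_\sigma0$): for every $F\in C_c(\mathbb{R})$, $\lim_{N\to\infty}\frac1N\sum_{i=1}^NF(\sigma_i(Z_N))=F(0)$, where $\sigma_i$ are the singular values; equivalently, for every $\varepsilon>0$, $\lim_{N\to\infty}\frac1N\#\{i:\sigma_i(Z_N)>\varepsilon\}=0$. *)

(* Defs.v *)
From mathcomp Require Import all_boot all_order all_algebra.
From mathcomp Require Import complex.
From mathcomp Require Import all_classical all_reals all_analysis.

Set Implicit Arguments.
Unset Strict Implicit.
Unset Printing Implicit Defensive.

Import Order.TTheory GRing.Theory Num.Theory.
Import numFieldNormedType.Exports.

Local Open Scope classical_set_scope.
Local Open Scope ring_scope.
Local Open Scope sesquilinear_scope.

Section Jacobi.
Context {R : realType}.
Local Notation mu := (@lebesgue_measure R).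

Definition Gamma (x : R) : R :=
  \int[mu]_(t in `]0, +oo[) (t `^ (x - 1) * expR (- t)).

Definition jacobi_weight (a b t : R) : R := (1 - t) `^ a * (1 + t) `^ b.

(* [size p] is the degree plus one, so [q] ranges over all polynomials of
   degree less than [j].  For [a, b > -1] these conditions determine [p]. *)
Definition is_jacobi (a b : R) (j : nat) (p : {poly R}) : Prop :=
  [/\ size p = j.+1,
      forall q : {poly R}, (size q <= j)%N ->
        \int[mu]_(t in `[-1, 1]) (p.[t] * q.[t] * jacobi_weight a b t) = 0
    & p.[1] = Gamma (j%:R + a + 1) / (Gamma (j%:R + 1) * Gamma (a + 1))].

(* Indices start at 0: entry [(i, j)] is the average over [[x_i, x_(i+1)]] of
   the basis function [P j], of degree [j], times the weight. *)
Definition histopolation_mx (a b : R) (P : nat -> {poly R}) (N : nat)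
    (x : nat -> R) : 'M[R]_N :=
  \matrix_(i < N, j < N)
    ((x i.+1 - x i)^-1 *
     \int[mu]_(t in `[x i, x i.+1]) ((P j).[t] * jacobi_weight a b t)).

(* C^1 on the closed interval: continuous there, differentiable inside, and
   the derivative extends continuously to the endpoints. *)
Definition C1_itv (a b : R) (g : R -> R) : Prop :=
  derivable_oo_LRcontinuous g a b /\
  exists dg : R -> R,
    {within `[a, b], continuous dg} /\ {in `]a, b[, derive1 g =1 dg}.

End Jacobi.

Section ZeroDistributed.
Context {R : realType}.

(* [spectral_diag] lists the eigenvalues of a normal matrix with multiplicity;
   those of [A^* A] are real and nonnegative. *)
Definition singular_value (n : nat) (A : 'M[R[i]]_n) (i : 'I_n) : R :=
  Num.sqrt (complex.Re (spectral_diag (A^t* *m A) 0 i)).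

Definition compactly_supported (F : R -> R) : Prop :=
  compact (closure [set t | F t != 0]).

(* This is also the meaning of being a GLT sequence with symbol 0. *)
Definition zero_distributed (Z : forall N : nat, 'M[R[i]]_N) : Prop :=
  forall F : R -> R, continuous F -> compactly_supported F ->
    N%:R^-1 * (\sum_(i < N) F (singular_value (Z N) i)) @[N --> \oo] --> F 0.

End ZeroDistributed.

(* Main.v *)
Require Import Defs.
From mathcomp Require Import all_boot all_order all_algebra.
From mathcomp Require Import ring lra zify.
From mathcomp Require Import complex.
From mathcomp Require Import all_classical all_reals all_analysis.
From mathcomp Require Import measurable_realfun.
Import Order.TTheory GRing.Theory Num.Theory.
Import numFieldNormedType.Exports.
Local Open Scope classical_set_scope.
Local Open Scope ring_scope.

(** Only the proportion of singular values of Z = H_N / N above each threshold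
    e matters (zero_distributed_count).  If B is any set of rows, at most
    #|B| + e^-2 * (squared Frobenius norm of Z outside B) singular values
    exceed e (count_singular_values), so it suffices to throw away a small
    proportion of the rows and to show that the others have a total squared
    norm o(N).

    The rows thrown away are those of the cells that contain a point where
    min (g', 1 + t) is small.  This function is positive almost everywhere and
    continuous, so its small level sets have small measure and they contain the
    bad cells as soon as the mesh is fine (few_small_cells).  In the other rows
    h_i is at least a constant over N, and the nodes stay away from -1
    (mesh_regular).  There Cauchy-Schwarz bounds the squared entry (i, j) by a
    constant over N times the integral over s_i of P_j^2 w, where w is the
    weight (1 - t)^alpha (1 + t)^(beta + 1).  Summing over i and j, everything
    reduces to showing that J_j, the integral of P_j^2 w over [-1, 1], is o(j).

    The weight w is the orthogonality weight of P_j divided by 1 - t.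
    Consequently P_j / P_j(1) minimizes the integral of q^2 w among polynomials
    of degree at most j with q(1) = 1 (jacobi_extremal), and J_j is at most
    P_j(1)^2 times that integral for any competitor q.  Here P_j(1), a quotient
    of Gamma values, is O(j^(alpha + 1)) (Gamma_quotient_le), while a power of
    the Dirichlet kernel, written as a Chebyshev polynomial of the third kind,
    has an integral O(j^(1/2 - 2 (alpha + 1)))
    (small_christoffel_polynomial).  Hence J_j = O(j^(1/2)), and the
    squared Frobenius norm outside B is O(N^(1/2)). *)

Set Implicit Arguments.
Unset Strict Implicit.
Unset Printing Implicit Defensive.

(** * Singular values and row norms *)

Section PartialIsometry.
Context {C : numClosedFieldType}.
Local Open Scope sesquilinear_scope.

Lemma mulmx_adjoint_diag m n (X : 'M[C]_(m, n)) i :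
  (X *m X^t*) i i = \sum_k `|X i k| ^+ 2.
Proof. by rewrite mxE; apply: eq_bigr => k _; rewrite !mxE normCK. Qed.

(** The matrix X = 1 - Q Q^* is a Hermitian idempotent, so X = X X^*, whose
    diagonal entries are squared norms of rows. *)
Lemma partial_isometry_diag_le1 m n (Q : 'M[C]_(m, n)) i :
  Q *m (Q^t* *m Q) = Q -> (Q *m Q^t*) i i <= 1.
Proof.
move=> QQ; pose X : 'M[C]_m := 1%:M - Q *m Q^t*.
have X1 : X^t* = X.
  by rewrite /X linearB /= trmx1 map_mxB map_mx1 trmx_mul map_mxM trmxCK.
have XX : X *m X^t* = X.
  rewrite X1 {2}/X mulmxBr mulmx1 {2}/X mulmxBl mul1mx.
  by rewrite -(mulmxA Q) (mulmxA _ Q) (mulmxA Q) QQ subrr subr0.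
rewrite -subr_ge0; have -> : 1 - (Q *m Q^t*) i i = X i i by rewrite !mxE eqxx.
by rewrite -XX mulmx_adjoint_diag sumr_ge0 // => k _; rewrite exprn_ge0.
Qed.

(** A singular value decomposition in a form without division: in the basis of
    eigenvectors of A^* A, the columns of A become orthogonal, the squared
    norm of each being an eigenvalue, and the norms of the rows do not change. *)
Lemma spectral_gram m n (A : 'M[C]_(m, n))
    (S := spectralmx (A^t* *m A)) (X := A *m S^t*) :
  X^t* *m X = diag_mx (spectral_diag (A^t* *m A)) /\ X *m X^t* = A *m A^t*.
Proof.
have uS : S \is unitarymx by exact: spectral_unitarymx.
have nM : A^t* *m A \is normalmx.
  by apply/normalmxP; rewrite trmx_mul map_mxM trmxCK.
have /orthomx_spectralP := nM; rewrite -/S invmx_unitary //.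
move: (spectral_diag _) => d eM.
have XE : X^t* = S *m A^t* by rewrite /X trmx_mul map_mxM trmxCK.
split; last first.
  rewrite XE /X mulmxA -(mulmxA A) -{2}(trmxCK S).
  have /unitarymxP -> : S^t* \is unitarymx by rewrite trmxC_unitary.
  by rewrite mulmx1.
rewrite XE /X mulmxA -(mulmxA S) eM !mulmxA (unitarymxP uS) mul1mx.
by rewrite -mulmxA (unitarymxP uS) mulmx1.
Qed.

End PartialIsometry.

Section SingularValueCount.
Context {R : realType}.
Local Open Scope sesquilinear_scope.

(** Normalize the columns of X = A S^* that belong to singular values above e
    and replace the others by 0: this gives a partial isometry Q, and the number
    of large singular values is its squared Frobenius norm.  Each row of Q
    contributes at most 1, which is used for the rows in B, and at most e^-2
    times the squared norm of the same row of A, which is used for the others.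
    It combines a perturbation of small rank with one of small norm. *)
Lemma count_singular_values (n : nat) (A : 'M[R]_n)
    (B : {set 'I_n}) (e : R) : 0 < e ->
  #|[set k | e < singular_value (map_mx (real_complex R) A) k]%SET|%:R <=
    #|B|%:R + e ^- 2 * \sum_(i in ~: B) \sum_j A i j ^+ 2.
Proof.
move=> e0; set K := [set k | _]%SET.
pose Z := map_mx (real_complex R) A.
have [] := spectral_gram Z.
set d := spectral_diag _; set X := Z *m _ => XX1 XX2.
have dE k : d 0 k = \sum_i `|X i k| ^+ 2.
  have /matrixP/(_ k k) := XX1; rewrite !mxE eqxx mulr1n => <-.
  by apply: eq_bigr => i _; rewrite !mxE normCK mulrC.
have d0 k : 0 <= d 0 k by rewrite dE sumr_ge0 // => i _; rewrite exprn_ge0.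
pose s k := singular_value Z k.
have s0 k : 0 <= s k by exact: sqrtr_ge0.
have sE k : d 0 k = (s k ^+ 2)%:C%C.
  rewrite /s /singular_value -/d sqr_sqrtr.
    by move: (d0 k); rewrite lecE /= => /andP[/eqP h _]; case: (d 0 k) h => a b /= ->.
  by move: (d0 k); rewrite lecE /= => /andP[_ ].
pose r : 'rV[R[i]]_n := \row_k (if k \in K then ((s k)^-1)%:C%C else 0).
have rC k : Num.conj (r 0 k) = r 0 k.
  by rewrite !mxE; case: ifP => _; rewrite ?conjC0 //; apply/CrealP; rewrite complex_real.
pose Q := X *m diag_mx r.
have QE : Q^t* = diag_mx r *m X^t*.
  rewrite /Q trmx_mul map_mxM tr_diag_mx map_diag_mx; congr (diag_mx _ *m _).
  by apply/rowP => k; rewrite mxE; exact: rC.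
have sK k : k \in K -> e < s k by rewrite inE.
have QQ1 : Q^t* *m Q = diag_mx (\row_k (k \in K)%:R).
  rewrite QE /Q mulmxA -(mulmxA (diag_mx r)) XX1 !mulmx_diag; congr diag_mx.
  apply/rowP => k; rewrite 2!mxE /= 2!mxE sE.
  have [kK|kK] := boolP (k \in K); rewrite ?mul0r ?mulr0 //.
  have sk0 : s k != 0 by rewrite gt_eqF // (lt_trans e0) // sK.
  by rewrite -!rmorphM /= expr2 mulKf // divff.
have QQ2 : Q *m (Q^t* *m Q) = Q.
  rewrite QQ1 /Q -mulmxA mulmx_diag; congr (_ *m diag_mx _).
  by apply/rowP => k; rewrite !mxE; case: ifP; rewrite ?mulr1 ?mulr0.
have trE : (#|K|%:R : R[i]) = \sum_i (Q *m Q^t*) i i.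
  rewrite -/(\tr (Q *m Q^t*)) mxtrace_mulC QQ1 mxtrace_diag.
  rewrite -sum1_card big_mkcond natr_sum; apply: eq_bigr => k _.
  by rewrite mxE; case: (k \in K).
have row_le i : (Q *m Q^t*) i i <= (e ^- 2 * \sum_j A i j ^+ 2)%:C%C.
  have -> : ((e ^- 2 * \sum_j A i j ^+ 2)%:C = (e ^- 2)%:C * (X *m X^t*) i i)%C.
    rewrite XX2 mulmx_adjoint_diag rmorphM /= rmorph_sum /=; congr (_ * _).
    apply: eq_bigr => j _; rewrite mxE /= normc_def /= expr0n /= addr0 sqrtr_sqr.
    by rewrite -rmorphXn /= real_normK // num_real.
  rewrite !mulmx_adjoint_diag mulr_sumr ler_sum // => k _.
  rewrite /Q mul_mx_diag mxE normrM exprMn mulrC ler_wpM2r ?exprn_ge0 //.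
  rewrite mxE; case: ifP => kK; last first.
    by rewrite normr0 expr0n /= lecR invr_ge0 sqr_ge0.
  rewrite normc_def /= expr0n /= addr0 sqrtr_sqr -rmorphXn /= lecR.
  rewrite real_normK ?num_real // exprVn lef_pV2 ?posrE ?exprn_gt0 //.
    by rewrite lerXn2r ?nnegrE ?(ltW e0) ?s0 // ltW // sK.
  by rewrite (lt_trans e0) // sK.
rewrite -lecR rmorphD /= !rmorph_nat trE (bigID (mem B)) /= lerD //.
  rewrite -sum1_card natr_sum ler_sum // => i _.
  exact: partial_isometry_diag_le1.
rewrite mulr_sumr rmorph_sum /=.
by under [leRHS]eq_bigl do rewrite inE; apply: ler_sum => i _.
Qed.

Lemma compactly_supported_bounded (F : R -> R) : continuous F ->
  compactly_supported F -> exists2 M : R, 0 <= M & forall x, `|F x| <= M.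
Proof.
move=> cF supF.
have /compact_bounded[M [_ HM]] := continuous_compact (continuous_subspaceT cF) supF.
exists (`|M| + 1); first by rewrite addr_ge0.
move=> x; have [->|Fx] := eqVneq (F x) 0; first by rewrite normr0 addr_ge0.
apply: (HM (`|M| + 1)) => /=; first by rewrite (le_lt_trans (ler_norm M)) // ltrDl.
by exists x => //; apply: subset_closure.
Qed.

(** The singular values below d / 2 have F close to F 0, and the others are too
    few to matter because F is bounded. *)
Lemma zero_distributed_count (Z : forall N : nat, 'M[R[i]]_N) :
  (forall e eta : R, 0 < e -> 0 < eta -> \forall N \near \oo,
     #|[set k | e < singular_value (Z N) k]%SET|%:R <= eta * N%:R) ->
  zero_distributed Z.
Proof.
move=> H F cF /(compactly_supported_bounded cF)[M M0 FM].
apply/cvgrPdist_lt => e e0.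
have := cF 0 => /cvgrPdist_lt/(_ (e / 2)); rewrite divr_gt0 // => /(_ isT).
rewrite -nbhs_nearE => /nbhs_ballP[d /= d0 Hd].
have d20 : 0 < d / 2 by rewrite divr_gt0.
pose eta := e / (8 * (M + 1)).
have M1 : 0 < 8 * (M + 1) by lra.
have eta0 : 0 < eta by rewrite divr_gt0.
near=> N.
have N0 : (0 < N)%N by near: N; exact: nbhs_infty_gt.
have NR0 : 0 < N%:R :> R by rewrite ltr0n.
have HN : #|[set k | d / 2 < singular_value (Z N) k]%SET|%:R <= eta * N%:R.
  by near: N; exact: H.
pose s k := singular_value (Z N) k.
have s0 k : 0 <= s k by exact: sqrtr_ge0.
have -> : F 0 = N%:R^-1 * \sum_(i < N) F 0.
  by rewrite sumr_const card_ord -[F 0 *+ N]mulr_natl mulKf ?gt_eqF.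
rewrite -mulrBr -sumrB normrM gtr0_norm ?invr_gt0 // mulrC ltr_pdivrMr //.
apply: le_lt_trans (ler_norm_sum _ _ _) _.
set K := [set k | _ < _]%SET in HN.
apply: (@le_lt_trans _ _ (\sum_(i < N) (e / 2 + (2 * M) *+ (i \in K)))).
  apply: ler_sum => i _.
  have [iK|iK] := boolP (i \in K).
    have := FM 0; have := FM (s i); have := ler_normB (F 0) (F (s i)).
    rewrite mulr1n -/(s i) => h1 h2 h3; lra.
  rewrite mulr0n addr0; apply/ltW/Hd; rewrite /ball /= sub0r normrN ger0_norm //.
  by move: iK; rewrite inE -leNgt => /le_lt_trans; apply; lra.
rewrite big_split /= sumr_const card_ord.
have -> : \sum_(i < N) (2 * M) *+ (i \in K) = 2 * M * #|K|%:R.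
  transitivity (\sum_(i in K) 2 * M).
    by rewrite [RHS]big_mkcond; apply: eq_bigr => i _; case: (i \in K).
  by rewrite sumr_const mulr_natr.
have h : 2 * M * #|K|%:R <= 2 * M * (eta * N%:R) by rewrite ler_wpM2l ?mulr_ge0.
have h' : 2 * M * (eta * N%:R) < (e / 2) * N%:R.
  rewrite mulrA ltr_pM2r // /eta mulrA ltr_pdivrMr //.
  have : 0 <= M * e by rewrite mulr_ge0 ?(ltW e0).
  by nra.
rewrite -[_ *+ N]mulr_natr; move: h h'; move: (N%:R) => n h h'.
have -> : e * n = e / 2 * n + e / 2 * n by field.
by rewrite ltrD2l; exact: le_lt_trans h h'.
Unshelve. all: by end_near. Qed.

End SingularValueCount.

(** * Continuous integrands on segments *)

Section SegmentIntegrals.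
Context {R : realType}.
Local Notation mu := (@lebesgue_measure R).

Lemma itv_continuous_integrable (a b : R) (f : R -> R) :
  {within `[a, b], continuous f} -> mu.-integrable `[a, b] (EFin \o f).
Proof.
move=> cf; apply: continuous_compact_integrable => //.
exact: segment_compact.
Qed.

Lemma within_continuousM (A : set R) (f g : R -> R) :
  {within A, continuous f} -> {within A, continuous g} ->
  {within A, continuous (fun t => f t * g t)}.
Proof. by move=> cf cg x; apply: continuousM; [exact: cf|exact: cg]. Qed.

Lemma within_continuousD (A : set R) (f g : R -> R) :
  {within A, continuous f} -> {within A, continuous g} ->
  {within A, continuous (fun t => f t + g t)}.
Proof. by move=> cf cg x; apply: continuousD; [exact: cf|exact: cg]. Qed.

Lemma within_continuous_cst (A : set R) (c : R) :
  {within A, continuous (fun=> c : R)}.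
Proof. by apply: continuous_subspaceT => x; exact: cst_continuous. Qed.

Lemma within_continuous_horner (A : set R) (p : {poly R}) :
  {within A, continuous (fun t => p.[t])}.
Proof. by apply: continuous_subspaceT => x; apply: continuous_horner. Qed.

Lemma Rintegral_itv_split (a c b : R) (f : R -> R) : a <= c -> c <= b ->
  {within `[a, b], continuous f} ->
  \int[mu]_(t in `[a, b]) f t =
  \int[mu]_(t in `[a, c]) f t + \int[mu]_(t in `[c, b]) f t.
Proof.
move=> ac cb cf; have fi := itv_continuous_integrable cf.
have := @Rintegral_itvB _ f (BLeft a) (BRight b) c fi.
rewrite !bnd_simp => /(_ ac cb) /eqP; rewrite subr_eq addrC => /eqP ->.
congr (_ + _); apply: Rintegral_itv_obnd_cbnd.
by apply: integrableS fi => //; apply: subset_itvr; rewrite bnd_simp.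
Qed.

Lemma le_itv_Rintegral (a b : R) (f g : R -> R) :
  {within `[a, b], continuous f} -> {within `[a, b], continuous g} ->
  (forall t, a <= t <= b -> f t <= g t) ->
  \int[mu]_(t in `[a, b]) f t <= \int[mu]_(t in `[a, b]) g t.
Proof.
by move=> cf cg fg; apply: le_Rintegral => //; exact: itv_continuous_integrable.
Qed.

Lemma Rintegral_itv_cst (a b c : R) : a <= b ->
  \int[mu]_(t in `[a, b]) c = c * (b - a).
Proof.
move=> ab; rewrite Rintegral_cst //= lebesgue_measure_itv /= lte_fin.
by case: ltgtP ab => //= -> _; rewrite subrr.
Qed.

Lemma Rintegral_itv_le_cst (a b c : R) (f : R -> R) : a <= b ->
  {within `[a, b], continuous f} -> (forall t, a <= t <= b -> f t <= c) ->
  \int[mu]_(t in `[a, b]) f t <= c * (b - a).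
Proof.
move=> ab cf fc; rewrite -Rintegral_itv_cst //.
by apply: le_itv_Rintegral => //; exact: within_continuous_cst.
Qed.

Lemma powR_continuous_nneg (p : R) : 0 <= p ->
  {within [set t | 0 <= t], continuous (fun t : R => t `^ p)}.
Proof.
rewrite le_eqVlt => /predU1P[<-|p0].
  have -> : (fun t : R => t `^ 0) = cst 1 by apply/funext => t; rewrite powRr0.
  by apply: continuous_subspaceT => x; exact: cst_continuous.
have -> : [set t : R | 0 <= t] = `[0, +oo[%classic.
  by apply/seteqP; split=> t /=; rewrite in_itv /= andbT.
apply/continuous_within_itvcyP; split.
  move=> x x0; apply/differentiable_continuous/derivable1_diffP.
  exact: derivable_powR.
by rewrite powR0 ?gt_eqF //; exact: powR_cvg0.
Qed.

Lemma jacobi_weight_continuous (p q : R) : 0 < p -> 0 < q ->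
  {within `[-1, 1], continuous (jacobi_weight p q)}.
Proof.
move=> p0 q0.
have comp (r : R) (h : R -> R) : 0 < r -> continuous h ->
    (forall t, -1 <= t <= 1 -> 0 <= h t) ->
    {within `[-1, 1], continuous (fun t => h t `^ r)}.
  move=> r0 ch h0; apply/subspace_continuousP => x Ax.
  have hx0 : 0 <= h x by apply: h0; move: Ax; rewrite /= in_itv.
  have /subspace_continuousP/(_ (h x) hx0) := powR_continuous_nneg (ltW r0).
  move=> ch0; apply: (@cvg_comp _ _ _ h (fun t => t `^ r) _ _ _ _ ch0) => U BU.
  change (nbhs x (fun t => `[-1, 1]%classic t -> U (h t))).
  have := ch x _ BU; apply: (@filterS _ (nbhs x)) => t Ut At; apply: Ut.
  by apply: h0; move: At; rewrite /= in_itv.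
apply: within_continuousM; apply: comp => //.
- by move=> x; apply: continuousB; [exact: cst_continuous|].
- by move=> t; lra.
- by move=> x; apply: continuousD; [exact: cst_continuous|].
- by move=> t; lra.
Qed.

Lemma jacobi_weight_ge0 (p q t : R) : 0 <= jacobi_weight p q t.
Proof. by rewrite mulr_ge0 ?powR_ge0. Qed.

(** Cauchy-Schwarz in variance form: integrate the square of the difference
    between f and its mean. *)
Lemma sqr_Rintegral_le (a b : R) (f : R -> R) : a < b ->
  {within `[a, b], continuous f} ->
  (\int[mu]_(t in `[a, b]) f t) ^+ 2 <=
  (b - a) * \int[mu]_(t in `[a, b]) (f t ^+ 2).
Proof.
move=> ab cf; have ba0 : 0 < b - a by rewrite subr_gt0.
have ba0' : b - a != 0 by rewrite gt_eqF.
set I1 := \int[mu]_(t in _) f t; set I2 := \int[mu]_(t in _) _.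
pose c := I1 / (b - a).
have c1 : {within `[a, b], continuous (fun t => - 2 * c * f t)}.
  by apply: within_continuousM => //; exact: within_continuous_cst.
have c2 : {within `[a, b], continuous (fun t => f t ^+ 2)} by exact: within_continuousM.
have c0 : {within `[a, b], continuous (fun=> c ^+ 2)} by exact: within_continuous_cst.
have c12 := within_continuousD c2 c1.
have : 0 <= \int[mu]_(t in `[a, b]) (f t ^+ 2 + - 2 * c * f t + c ^+ 2).
  apply: Rintegral_ge0 => t _.
  have -> : f t ^+ 2 + - 2 * c * f t + c ^+ 2 = (f t - c) ^+ 2 by ring.
  exact: sqr_ge0.
rewrite RintegralD //; [|exact: itv_continuous_integrable..].
rewrite RintegralD //; [|exact: itv_continuous_integrable..].
rewrite RintegralZl //; last exact: itv_continuous_integrable.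
rewrite Rintegral_itv_cst ?(ltW ab) // -/I1 -/I2 => h.
rewrite -subr_ge0.
have -> : (b - a) * I2 - I1 ^+ 2 = (b - a) * (I2 + - 2 * c * I1 + c ^+ 2 * (b - a)).
  by rewrite /c; field.
by rewrite mulr_ge0 // ltW.
Qed.

Lemma Rintegral_itv_sum (x : nat -> R) (f : R -> R) (n : nat) :
  {homo x : i j / (i <= j)%N >-> i <= j} ->
  {within `[x 0, x n], continuous f} ->
  \int[mu]_(t in `[x 0, x n]) f t =
  \sum_(i < n) \int[mu]_(t in `[x i, x i.+1]) f t.
Proof.
move=> hx; elim: n => [|n IH] cf; first by rewrite big_ord0 set_itv1 Rintegral_set1.
rewrite big_ord_recr /= -IH.
  by apply: Rintegral_itv_split => //; apply: hx.
by apply: continuous_subspaceW cf; apply: subset_itvl; rewrite bnd_simp hx.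
Qed.

End SegmentIntegrals.

(** * Growth of Gamma quotients *)

Section GammaRecurrence.
Context {R : realType}.
Local Notation mu := (@lebesgue_measure R).

Definition gamma_integrand (x t : R) : R := t `^ x * expR (- t).

Lemma expRN_continuous : continuous (fun t : R => expR (- t)).
Proof.
move=> t; apply: continuous_comp; first exact: oppr_continuous.
exact: continuous_expR.
Qed.

Lemma gamma_integrand_continuous (x b : R) : 0 <= x ->
  {within `[0, b], continuous (gamma_integrand x)}.
Proof.
move=> x0; apply: within_continuousM.
  apply: continuous_subspaceW (powR_continuous_nneg x0) => t /=.
  by rewrite in_itv /= => /andP[].
exact: continuous_subspaceT expRN_continuous.
Qed.

Lemma gamma_integrand_by_parts (x b : R) : 1 <= x -> 0 < b ->
  \int[mu]_(t in `[0, b]) gamma_integrand x t + gamma_integrand x b =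
  x * \int[mu]_(t in `[0, b]) gamma_integrand (x - 1) t.
Proof.
move=> x1 b0; have x0 : 0 < x by lra.
have xB : 0 <= x - 1 by lra.
have derE (t : R) : is_derive t 1 (fun s : R => - expR (- s)) (expR (- t)).
  have h : is_derive t 1 (- (expR \o -%R) : R -> R) (- (expR (- t) * - 1)).
    by apply: is_deriveN; apply: is_derive1_comp.
  by apply: (is_derive_eq h); rewrite mulrN1 opprK.
have sub : `[0, b] `<=` [set t : R | 0 <= t].
  by move=> t /=; rewrite in_itv /= => /andP[].
have cx := continuous_subspaceW sub (powR_continuous_nneg (ltW x0)).
have cx1 := continuous_subspaceW sub (powR_continuous_nneg xB).
have /(continuous_within_itvP _ b0)[_ cx0 cxb] := cx.
have cNe : continuous (fun s : R => - expR (- s)).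
  by move=> t; apply: cvgN; exact: expRN_continuous.
have := @Rintegration_by_parts R (fun t => t `^ x) (fun t => - expR (- t))
  (fun t => x * t `^ (x - 1)) (fun t => expR (- t)) 0 b b0.
move=> /(_ _ _ _ _ _ _)/wrap[].
- apply: within_continuousM cx1.
  by apply: continuous_subspaceT => t; exact: cst_continuous.
- split=> // t; rewrite in_itv /= => /andP[t0 _].
  by apply: derivable_powR; rewrite in_itv /= t0.
- by move=> t; rewrite in_itv /= => /andP[t0 _]; apply: powR_derive1; rewrite in_itv /= t0.
- exact: continuous_subspaceT expRN_continuous.
- split=> [t _||]; first exact: (@ex_derive _ _ _ _ _ _ _ (derE t)).
    by apply: cvg_at_right_filter; exact: cNe.
  by apply: cvg_at_left_filter; exact: cNe.
- by move=> t _; rewrite derive1E; exact: (@derive_val _ _ _ _ _ _ _ (derE t)).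
rewrite /gamma_integrand => ->; rewrite powR0 ?gt_eqF // mul0r subr0.
have -> : \int[mu]_(t in `[0, b]) (x * t `^ (x - 1) * - expR (- t)) =
    \int[mu]_(t in `[0, b]) (- x * (gamma_integrand (x - 1) t)).
  by apply: eq_Rintegral => t _; rewrite /gamma_integrand; ring.
rewrite RintegralZl //; last exact/itv_continuous_integrable/gamma_integrand_continuous.
by rewrite /gamma_integrand; ring.
Qed.

(** From exp N = exp (N / (x + 1)) ^ (x + 1) and exp u >= u, the integrand at N
    is at most (x + 1)^(x + 1) / N. *)
Lemma gamma_integrand_cvg0 (x : R) : 0 <= x -> gamma_integrand x n.+1%:R @[n --> \oo] --> 0.
Proof.
move=> x0; have x1 : 0 < x + 1 by lra.
have x1' : x + 1 != 0 by rewrite gt_eqF.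
pose c := (x + 1) `^ (x + 1).
apply: (@squeeze_cvgr _ _ _ _ (cst 0) (fun n => c * n.+1%:R^-1)).
- near=> n; apply/andP; split; first by rewrite mulr_ge0 ?powR_ge0 ?expR_ge0.
  set N : R := n.+1%:R; have N0 : 0 < N by rewrite ltr0n.
  have NE : N * N `^ x <= c * expR N.
    rewrite -{1}[x](addrK 1) mulr_powRB1 ?(ltW N0) //.
    have -> : expR N = expR (N / (x + 1)) `^ (x + 1) by rewrite -expRM divfK.
    rewrite -powRM ?(ltW x1) ?expR_ge0 //.
    rewrite ge0_ler_powR ?nnegrE ?(ltW x1) ?(ltW N0) // ?mulr_ge0 ?expR_ge0 ?(ltW x1) //.
    rewrite mulrC -ler_pdivrMr //.
    by apply: le_trans (expR_ge1Dx _); rewrite lerDr.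
  rewrite /gamma_integrand expRN ler_pdivrMr ?expR_gt0 // mulrAC ler_pdivlMr // mulrC.
  exact: NE.
- exact: cvg_cst.
- rewrite -[X in _ --> X](mulr0 c); apply: cvgM; first exact: cvg_cst.
  exact: cvg_harmonic.
Unshelve. all: by end_near. Qed.

Lemma gamma_integrand_integral_cvg (x : R) : 0 <= x ->
  (\int[mu]_(t in `[0, n.+1%:R]) gamma_integrand x t)%:E @[n --> \oo] -->
  (\int[mu]_(t in `]0%R, +oo[) (gamma_integrand x t)%:E)%E.
Proof.
move=> x0.
have mg : measurable_fun (`]0, +oo[ : set R) (gamma_integrand x).
  apply: open_continuous_measurable_fun => // t.
  rewrite inE /= in_itv /= andbT => t0.
  apply: cvgM; last exact: expRN_continuous.
  have /derivable1_diffP/differentiable_continuous : derivable (fun s : R => s `^ x) t 1.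
    by apply: derivable_powR; rewrite in_itv /= t0.
  exact.
have sub (b : R) : `]0, b] `<=` (`]0, +oo[ : set R).
  by move=> t /=; rewrite !in_itv /= => /andP[->].
have -> : (fun n => (\int[mu]_(t in `[0, n.+1%:R]) gamma_integrand x t)%:E) =
    (fun n => \int[mu]_(t in `]0%R, (0 + n.+1%:R)%R]) (gamma_integrand x t)%:E)%E.
  apply/funext => n; rewrite add0r /Rintegral fineK.
    rewrite -integral_itv_obnd_cbnd //.
    by apply/measurable_EFinP; apply: measurable_funS mg => //; exact: sub.
  by apply: integrable_fin_num => //; exact/itv_continuous_integrable/gamma_integrand_continuous.
rewrite itv_bndy_bigcup_BRight /=.
rewrite (cvg_shiftS (fun n => \int[mu]_(t in `]0%R, (0 + n%:R)%R]) (gamma_integrand x t)%:E)%E).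
apply: ge0_nondecreasing_set_cvg_integral.
- move=> m n mn; apply/subsetPset => t /=; rewrite !in_itv /= => /andP[-> tm] /=.
  by rewrite (le_trans tm) // !add0r ler_nat.
- by move=> n; exact: measurable_itv.
- by move=> n; apply/measurable_EFinP; apply: measurable_funS mg => //; exact: sub.
- by move=> n t _; rewrite lee_fin mulr_ge0 ?powR_ge0 ?expR_ge0.
Qed.

(** Integration by parts on [0, n], then n tends to infinity.  The limit is
    taken in the extended reals, where the identity holds even for infinite
    integrals; taking finite parts preserves it, as fine +oo = 0. *)
Lemma GammaD1 (x : R) : 1 <= x -> Gamma (x + 1) = x * Gamma x.
Proof.
move=> x1; have x0 : 0 < x by lra.
rewrite /Gamma addrK /Rintegral.
set I1 := (\int[mu]_(t in _) (t `^ x * _)%:E)%E.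
set I0 := (\int[mu]_(t in _) _)%E.
have I0_ge0 : (0 <= I0)%E.
  by apply: integral_ge0 => t _; rewrite lee_fin mulr_ge0 ?powR_ge0 ?expR_ge0.
have e1 : I1 = (x%:E * I0)%E.
  have c1 := gamma_integrand_integral_cvg (ltW x0).
  have xB : 0 <= x - 1 by lra.
  have c0 := gamma_integrand_integral_cvg xB.
  have cg : (gamma_integrand x n.+1%:R)%:E @[n --> \oo] --> (0:R)%:E.
    by apply: cvg_EFin; [exact: nearW|exact: gamma_integrand_cvg0 (ltW x0)].
  have h1 := cvgeD (@fin_num_adde_defl R _ 0%:E isT) c1 cg; rewrite adde0 in h1.
  have h2 := cvgeZl (isT : x%:E \is a fin_num) c0.
  have eE : (fun n => ((\int[mu]_(t in `[0, n.+1%:R]) gamma_integrand x t)%:E +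
      (gamma_integrand x n.+1%:R)%:E)%E) =
      (fun n => (x%:E * (\int[mu]_(t in `[0, n.+1%:R]) gamma_integrand (x - 1) t)%:E)%E).
    by apply/funext => n; rewrite -EFinD gamma_integrand_by_parts ?ltr0n // EFinM.
  by rewrite eE in h1; exact: (cvg_unique (@ereal_hausdorff R) (h1 _) h2).
rewrite e1; case: I0 I0_ge0 {e1} => [r||] //= _.
by rewrite mulr0 gt0_muley ?lte_fin.
Qed.

End GammaRecurrence.

Section GammaQuotients.
Context {R : realType}.

(** Young's inequality for y and 1 with the exponents a and a / (a - 1). *)
Lemma powR_bernoulli (a y : R) : 1 < a -> 0 <= y -> 1 + a * (y - 1) <= y `^ a.
Proof.
move=> a1 y0; have a0 : 0 < a by lra.
have a0' : a != 0 by rewrite gt_eqF.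
have aB : a - 1 != 0 by rewrite subr_eq0 gt_eqF.
have := @conjugate_powR R y 1 a (a / (a - 1)) y0 ler01 a0.
rewrite divr_gt0 ?subr_gt0 // powR1 mulr1 => /(_ isT).
have -> : a^-1 + (a / (a - 1))^-1 = 1 by field; rewrite a0' aB.
move=> /(_ erefl); rewrite mul1r -(ler_pM2l a0).
have -> : a * (y `^ a / a + (a / (a - 1))^-1) = y `^ a + (a - 1).
  by field; rewrite a0' aB.
by move=> h; lra.
Qed.

(** By Bernoulli, 1 + a / n <= ((n + 1) / n) ^ a, and the product of the right
    hand sides telescopes. *)
Lemma quotient_recurrence_le (a : R) (u : nat -> R) : 1 < a ->
  (forall j, u j.+1 = (j.+1%:R + a) / j.+1%:R * u j) ->
  forall j, `|u j| <= `|u 0| * j.+1%:R `^ a.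
Proof.
move=> a1 uS; have a0 : 0 < a by lra.
elim=> [|j IH]; first by rewrite powR1 mulr1.
have n1 : 1 <= j.+1%:R :> R by rewrite ler1n.
have n0 : 0 < j.+1%:R :> R by rewrite ltr0n.
rewrite uS normrM -[in leRHS]natr1; move: (j.+1%:R) n1 n0 IH => n n1 n0 IH.
have na0 : 0 <= (n + a) / n by rewrite divr_ge0 ?addr_ge0 // ltW.
rewrite ger0_norm //; apply: le_trans (ler_wpM2l na0 IH) _.
rewrite mulrCA ler_wpM2l //.
have -> : n + 1 = (1 + n^-1) * n by field; rewrite gt_eqF.
rewrite powRM ?addr_ge0 ?invr_ge0 ?(ltW n0) // ler_wpM2r ?powR_ge0 //.
apply: le_trans (powR_bernoulli a1 _); last by rewrite addr_ge0 ?invr_ge0 ?(ltW n0).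
by rewrite [1 + n^-1]addrC addrK mulrDl divff // gt_eqF.
Qed.

(** This is the growth of the values at 1 of the Jacobi polynomials. *)
Lemma Gamma_quotient_le (a : R) : 1 < a -> exists2 C : R, 0 <= C &
  forall j, `|Gamma (j%:R + a + 1) / (Gamma (j%:R + 1) * Gamma (a + 1))| <=
    C * j.+1%:R `^ a.
Proof.
move=> a1; have a0 : 0 < a by lra.
have := @GammaD1 R; move: (@Gamma R) => G GD1.
pose u j := G (j%:R + a + 1) / (G (j%:R + 1) * G (a + 1)).
exists `|u 0%N|; first exact: normr_ge0.
apply: (@quotient_recurrence_le a u) => // j; rewrite /u.
have nE : j.+1%:R = j%:R + 1 :> R by rewrite natr1.
have n1 : 1 <= j.+1%:R :> R by rewrite ler1n.
have -> : G (j.+1%:R + a + 1) = (j.+1%:R + a) * G (j%:R + a + 1).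
  by rewrite GD1 ?ler_wpDr ?(ltW a0) // {2}nE (addrAC j%:R 1 a).
have -> : G (j.+1%:R + 1) = j.+1%:R * G (j%:R + 1) by rewrite GD1 // -nE.
by rewrite !invfM; ring.
Qed.

End GammaQuotients.

(** * Chebyshev polynomials of the third kind *)

Section ChebyshevV.
Context {R : realType}.

(** V_n (cos th) = sin ((n + 1/2) th) / sin (th / 2), the Dirichlet kernel. *)
Fixpoint chebyshevV (n : nat) : {poly R} :=
  match n with
  | 0 => 1
  | n1.+1 => match n1 with
             | 0 => 2%:P * 'X + 1
             | n2.+1 => 2%:P * 'X * chebyshevV n1 - chebyshevV n2
             end
  end.

Lemma chebyshevV_rec n :
  chebyshevV n.+2 = 2%:P * 'X * chebyshevV n.+1 - chebyshevV n.
Proof. by []. Qed.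

Lemma size_chebyshevV n : (size (chebyshevV n) <= n.+1)%N.
Proof.
suff: (size (chebyshevV n) <= n.+1)%N && (size (chebyshevV n.+1) <= n.+2)%N.
  by case/andP.
have s2X : (size (2%:P * 'X : {poly R})%R <= 2)%N.
  by rewrite mul_polyC (leq_trans (size_scale_leq _ _)) // size_polyX.
elim: n => [|n /andP[IH1 IH2]].
  rewrite /= size_poly1 /= (leq_trans (size_polyD _ _)) // geq_max s2X.
  by rewrite size_poly1.
rewrite IH2 chebyshevV_rec (leq_trans (size_polyD _ _)) // geq_max size_polyN.
rewrite (leq_trans IH1) ?leqnSn 1?andbT //; last by rewrite ltnW.
by rewrite (leq_trans (size_polyMleq _ _)) //; move: s2X IH2; lia.
Qed.

Lemma chebyshevV_at1 n : (chebyshevV n).[1] = (n.*2.+1)%:R.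
Proof.
suff: (chebyshevV n).[1] = (n.*2.+1)%:R /\ (chebyshevV n.+1).[1] = (n.+1.*2.+1)%:R.
  by case.
elim: n => [|n [IH1 IH2]]; first by split; rewrite /= ?hornerE ?mulr1 -?natr1 ?add0r.
split=> //; rewrite chebyshevV_rec !hornerE IH1 IH2 !doubleS.
by rewrite -!natr1; lra.
Qed.

(** The quadratic form y^2 - 2 t x y + x^2 is invariant under the step
    (x, y) |-> (y, 2 t y - x) of the recurrence. *)
Lemma chebyshevV_invariant n (t : R) :
  (chebyshevV n.+1).[t] ^+ 2 - 2 * t * (chebyshevV n.+1).[t] * (chebyshevV n).[t]
  + (chebyshevV n).[t] ^+ 2 = 2 * (1 + t).
Proof.
elim: n => [|n IH]; first by rewrite /= !hornerE; ring.
by rewrite -IH chebyshevV_rec !hornerE; ring.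
Qed.

(** Trigonometrically, |sin ((n + 1/2) th)| <= 1.  Algebraically, completing the
    square in the invariant leaves (1 - t^2) V_n(t)^2 <= 2 (1 + t). *)
Lemma chebyshevV_decay n (t : R) : -1 <= t <= 1 ->
  (1 - t) * (chebyshevV n).[t] ^+ 2 <= 2.
Proof.
move=> /andP[t1 t2]; have := chebyshevV_invariant n t.
set v := (_ n).[t]; set w := (_ n.+1).[t] => inv.
have [tE|tN] := eqVneq t (-1).
  suff -> : v ^+ 2 = 1 by rewrite tE; lra.
  rewrite /v tE; elim: (n) => [|k IH]; first by rewrite /= !hornerE expr1n.
  have := chebyshevV_invariant k (-1).
  rewrite subrr mulr0 => h.
  have /eqP : ((chebyshevV k.+1).[-1] + (chebyshevV k).[-1]) ^+ 2 = 0.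
    by rewrite -h; ring.
  by rewrite expf_eq0 /= addr_eq0 => /eqP ->; rewrite sqrrN.
have t0 : 0 < 1 + t by rewrite -(opprK 1) addrC subr_gt0 lt_neqAle eq_sym tN.
rewrite -(ler_pM2l t0).
have -> : (1 + t) * 2 = (w - t * v) ^+ 2 + (1 + t) * ((1 - t) * v ^+ 2).
  by rewrite mulrC -inv; ring.
by rewrite lerDr sqr_ge0.
Qed.

(** The difference is twice a Chebyshev polynomial of the first kind.  It obeys
    the same recurrence, for which the invariant is now 4 (1 - t^2). *)
Lemma chebyshevV_step n (t : R) : -1 <= t <= 1 ->
  `|(chebyshevV n.+1).[t] - (chebyshevV n).[t]| <= 2.
Proof.
move=> /andP[t1 t2].
pose d k := (chebyshevV k.+1).[t] - (chebyshevV k).[t].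
(* The recurrence for the differences extends to index -1 with the value 2. *)
have rec k : d k.+1 = 2 * t * d k - (if k is k1.+1 then d k1 else 2).
  by case: k => [|k]; rewrite /d !chebyshevV_rec /= !hornerE; ring.
have inv k : d k.+1 ^+ 2 - 2 * t * d k.+1 * d k + d k ^+ 2 = 4 * (1 - t ^+ 2).
  elim: k => [|k IH]; first by rewrite rec /d /= !hornerE; ring.
  by rewrite -IH rec; ring.
suff : d n ^+ 2 <= 4.
  move=> h; rewrite -/(d n) -(@ler_pXn2r _ 2) ?nnegrE //.
  by rewrite real_normK ?num_real // (le_trans h) // -natrX.
have [t21|t21] := eqVneq (t ^+ 2) 1.
  elim: n => [|n IH]; first by rewrite /d /= !hornerE; lra.
  have := inv n; rewrite t21 => h.
  have /eqP : (d n.+1 - t * d n) ^+ 2 = 0.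
    rewrite sqrrB exprMn t21; move: h; lra.
  by rewrite expf_eq0 /= subr_eq0 => /eqP ->; rewrite exprMn t21 mul1r.
have t21' : 0 < 1 - t ^+ 2.
  by rewrite subr_gt0 lt_neqAle t21; nra.
rewrite -(ler_pM2l t21') [leRHS]mulrC -(inv n).
have -> : d n.+1 ^+ 2 - 2 * t * d n.+1 * d n + d n ^+ 2 =
  (d n.+1 - t * d n) ^+ 2 + (1 - t ^+ 2) * d n ^+ 2 by ring.
by rewrite lerDr sqr_ge0.
Qed.

Lemma chebyshevV_le n (t : R) : -1 <= t <= 1 ->
  `|(chebyshevV n).[t]| <= (n.*2.+1)%:R.
Proof.
move=> t1; elim: n => [|n IH]; first by rewrite /= !hornerE normr1.
rewrite -(subrK (chebyshevV n).[t] (chebyshevV n.+1).[t]).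
rewrite (le_trans (ler_normD _ _)) //.
have := chebyshevV_step n t1; rewrite doubleS -!natr1; move: IH.
by rewrite -natr1; lra.
Qed.

End ChebyshevV.

Section ChebyshevPowers.
Context {R : realType}.
Local Notation mu := (@lebesgue_measure R).

(** With D = V_m(1), the polynomial q = (V_m / D)^k satisfies |q| <= 1 and
    q^2 <= (2 / (D^2 (1 - t)))^k.  The first bound is used for 1 - t <= s, the
    second one for 1 - t >= s, where the condition p <= k makes the product with
    (1 - t)^p largest at 1 - t = s. *)
Lemma chebyshevV_power_integral (p r D s : R) (m k : nat) :
  0 < p -> 0 < r -> p <= k%:R -> D = m.*2.+1%:R ->
  0 < s <= 1 ->
  \int[mu]_(t in `[-1, 1])
     (((D^-1 *: chebyshevV m) ^+ k).[t] ^+ 2 * jacobi_weight p r t) <=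
  2 `^ r * (s `^ (p + 1) + 2 ^+ k.+1 * D ^- (2 * k) * s `^ (p - k%:R)).
Proof.
move=> p0 r0 pk DE /andP[s0 s1].
have D0 : 0 < D by rewrite DE ltr0n.
set q := (_ ^+ k).
have qE t : q.[t] ^+ 2 = ((D^-1 * (chebyshevV m).[t]) ^+ 2) ^+ k.
  by rewrite /q horner_exp hornerZ exprAC.
have q1 t : -1 <= t <= 1 -> q.[t] ^+ 2 <= 1.
  move=> t1; rewrite qE exprn_ile1 ?sqr_ge0 //.
  rewrite -real_normK ?num_real // exprn_ile1 // normrM ger0_norm ?invr_ge0 ?(ltW D0) //.
  by rewrite ler_pdivrMl // mulr1 DE chebyshevV_le.
have q2 t : -1 <= t < 1 -> q.[t] ^+ 2 <= 2 ^+ k * D ^- (2 * k) * (1 - t) ^- k.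
  move=> /andP[t1 t2]; have t0 : 0 < 1 - t by lra.
  have -> : 2 ^+ k * D ^- (2 * k) * (1 - t) ^- k =
      (2 * D ^- 2 * (1 - t)^-1) ^+ k by rewrite !exprMn !exprVn exprM.
  rewrite qE lerXn2r ?nnegrE ?sqr_ge0 ?mulr_ge0 ?invr_ge0 ?sqr_ge0 ?(ltW t0) //.
  rewrite ler_pdivlMr // exprMn exprVn mulrC mulrCA mulrC.
  rewrite ler_wpM2r ?invr_ge0 ?sqr_ge0 //.
  by rewrite chebyshevV_decay // t1 ltW.
have w2 t : -1 <= t <= 1 -> (1 + t) `^ r <= 2 `^ r.
  by move=> /andP[t1 t2]; rewrite ge0_ler_powR ?nnegrE ?(ltW r0) //; lra.
have cf : {within `[-1, 1], continuous (fun t => q.[t] ^+ 2 * jacobi_weight p r t)}.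
  apply: within_continuousM; last exact: jacobi_weight_continuous.
  by apply: within_continuousM; exact: within_continuous_horner.
rewrite (Rintegral_itv_split (c := 1 - s)) //; [|lra|lra].
have sub1 : `[-1, 1 - s] `<=` (`[-1, 1] : set R).
  by move=> t /=; rewrite !in_itv /= => /andP[]; lra.
have sub2 : `[1 - s, 1] `<=` (`[-1, 1] : set R).
  by move=> t /=; rewrite !in_itv /= => /andP[]; lra.
rewrite addrC mulrDr lerD //.
- apply: (le_trans (@Rintegral_itv_le_cst R _ _ (2 `^ r * s `^ p) _ _ _ _)) => //.
  + lra.
  + exact: continuous_subspaceW cf.
  + move=> t t1; have t1' : -1 <= t <= 1 by lra.
    rewrite -[leRHS]mul1r ler_pM ?sqr_ge0 ?jacobi_weight_ge0 ?q1 //.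
    rewrite mulrC ler_pM ?powR_ge0 ?w2 //.
    by rewrite ge0_ler_powR ?nnegrE ?(ltW p0) //; lra.
  + rewrite subKr -mulrA ler_wpM2l ?powR_ge0 // mulrC.
    by rewrite -{1}[p](addrK 1) mulr_powRB1 ?(ltW s0) //; lra.
- apply: (le_trans (@Rintegral_itv_le_cst R _ _
    (2 `^ r * (2 ^+ k * D ^- (2 * k) * s `^ (p - k%:R))) _ _ _ _)) => //.
  + lra.
  + exact: continuous_subspaceW cf.
  + move=> t t1; have t1' : -1 <= t <= 1 by lra.
    have t0 : 0 < 1 - t by lra.
    rewrite /jacobi_weight (mulrA (q.[t] ^+ 2)) [leLHS]mulrC.
    rewrite ler_pM ?powR_ge0 ?w2 //.
      by rewrite mulr_ge0 ?sqr_ge0 ?powR_ge0.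
    apply: (@le_trans _ _ (2 ^+ k * D ^- (2 * k) * (1 - t) ^- k * (1 - t) `^ p)).
      by rewrite ler_wpM2r ?powR_ge0 ?q2 //; lra.
    rewrite -!mulrA ler_wpM2l ?exprn_ge0 // ler_wpM2l ?invr_ge0 ?exprn_ge0 ?(ltW D0) //.
    rewrite mulrC -powR_mulrn ?(ltW t0) // -powRB; last by rewrite (gt_eqF t0) implybT.
    rewrite -[p - _]opprB !powRN lef_pV2 ?posrE ?powR_gt0 //.
    by rewrite ge0_ler_powR ?nnegrE ?subr_ge0 ?(ltW s0) ?(ltW t0) //; lra.
  + rewrite -mulrA ler_wpM2l ?powR_ge0 // exprS.
    set z := s `^ _; have z0 : 0 <= z by rewrite powR_ge0.
    set y := 2 ^+ k * _; have y0 : 0 <= y by rewrite mulr_ge0 ?invr_ge0 ?exprn_ge0 ?(ltW D0).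
    have -> : 2 * 2 ^+ k * D ^- (2 * k) * z = y * z * 2 by rewrite /y; ring.
    rewrite ler_wpM2l ?(mulr_ge0 y0 z0) //.
    by rewrite opprK addrAC lerBlDr lerDl ltW.
Qed.

(** The infimum of these integrals, a Christoffel function at the endpoint, has
    order j^(- 2 (p + 1)); losing a factor j^(1/2) leaves room for crude bounds.
    Take q as above with m = j %/ k, so that D is at least (j + 1) / k. *)
Lemma small_christoffel_polynomial (p r : R) : 0 < p -> 0 < r ->
  exists2 C : R, 0 <= C & forall j, exists q : {poly R},
    [/\ (size q <= j.+1)%N, q.[1] = 1 &
    \int[mu]_(t in `[-1, 1]) (q.[t] ^+ 2 * jacobi_weight p r t) <=
    C * j.+1%:R `^ (2^-1 - 2 * (p + 1))].
Proof.
move=> p0 r0.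
(* With this k the exponent lost below, 2 (p + 1) / (k + 1), is at most 1/2. *)
pose k := Num.bound (4 * (p + 1)).
have kp : 4 * (p + 1) < k%:R by apply: archi_boundP; lra.
have kR0 : 0 < k%:R :> R by apply: le_lt_trans kp; lra.
have k0 : (0 < k)%N by rewrite -(ltr_nat R).
have kp' : p <= k%:R by lra.
pose e : R := 2^-1 - 2 * (p + 1).
have e0 : e <= 0 by rewrite /e; lra.
pose C0 : R := 2 `^ r * (1 + 2 ^+ k.+1).
have C00 : 0 <= C0 by rewrite mulr_ge0 ?powR_ge0 ?addr_ge0 ?exprn_ge0.
exists (C0 * k%:R `^ (- e)); first by rewrite mulr_ge0 ?powR_ge0.
move=> j; pose m := (j %/ k)%N.
have [D DE] : exists D : R, D = m.*2.+1%:R by eexists.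
have D1 : 1 <= D by rewrite DE ler1n.
have D0 : 0 < D by exact: lt_le_trans D1.
have Dj : j.+1%:R <= k%:R * D.
  rewrite DE -natrM ler_nat.
  have := ltn_ceil j k0; rewrite -/m => h.
  apply: (leq_trans h); rewrite mulnC leq_mul2l; apply/orP; right; lia.
pose q := (D^-1 *: chebyshevV m) ^+ k.
exists q; split.
- rewrite /q; apply: leq_trans (size_poly_exp_leq _ _) _.
  rewrite ltnS; apply: (@leq_trans (m * k)%N); last exact: leq_divM.
  rewrite leq_mul2r; apply/orP; right.
  rewrite -subn1 leq_subLR add1n (leq_trans (size_scale_leq _ _)) //.
  exact: size_chebyshevV.
- by rewrite /q horner_exp hornerZ chebyshevV_at1 -DE mulVf ?gt_eqF // expr1n.
pose c : R := - (2 * k)%:R / k.+1%:R.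
have k1 : 0 < k.+1%:R :> R by rewrite ltr0n.
have c0 : c <= 0 by rewrite /c mulNr oppr_le0 divr_ge0.
(* This s makes D ^- (2 * k) * s ^ (- (k + 1)) = 1, which balances the two
   terms; then s ^ (p + 1) = D ^ (- 2 (p + 1) + 2 (p + 1) / (k + 1)). *)
pose s := D `^ c.
have s0 : 0 < s by rewrite powR_gt0.
have s1 : s <= 1 by rewrite -(powRr0 D) ler_powR.
have s01 : 0 < s <= 1 by rewrite s0 s1.
apply: le_trans (chebyshevV_power_integral p0 r0 kp' DE s01) _.
have skE : s `^ (p - k%:R) = s `^ (p + 1) * D ^+ (2 * k).
  have -> : p - k%:R = p + 1 + - k.+1%:R by rewrite -natr1; ring.
  rewrite powRD; last by rewrite (gt_eqF s0) implybT.
  congr (_ * _); rewrite /s -powRrM /c mulrN !mulNr opprK divfK ?gt_eqF //.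
  by rewrite powR_mulrn // ltW.
rewrite skE.
have -> : 2 ^+ k.+1 * D ^- (2 * k) * (s `^ (p + 1) * D ^+ (2 * k)) =
    2 ^+ k.+1 * s `^ (p + 1).
  by field; rewrite gt_eqF // exprn_gt0.
have -> : 2 `^ r * (s `^ (p + 1) + 2 ^+ k.+1 * s `^ (p + 1)) = C0 * s `^ (p + 1).
  by rewrite /C0; ring.
rewrite -mulrA ler_wpM2l // -/e.
apply: (@le_trans _ _ (D `^ e)).
  rewrite /s -powRrM ler_powR // /c /e.
  rewrite -(ler_pM2r k1) mulrAC divfK ?gt_eqF //.
  by rewrite -[k.+1%:R]natr1 natrM; lra.
have [f fE] : exists f, e = - f by exists (- e); rewrite opprK.
rewrite fE opprK !powRN; have f0 : 0 <= f by rewrite -oppr_le0 -fE.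
rewrite ler_pdivlMr ?powR_gt0 // mulrC ler_pdivrMr ?powR_gt0 //.
rewrite -powRM ?(ltW D0) ?(ltW kR0) //.
by rewrite ge0_ler_powR ?nnegrE // mulr_ge0 // ltW.
Qed.

End ChebyshevPowers.

(** * Norms of Jacobi polynomials *)

Section JacobiNorms.
Context {R : realType}.
Local Notation mu := (@lebesgue_measure R).

(** Since P - P(1) q vanishes at 1, it is (1 - t) times a polynomial of lower
    degree than P, and the factor 1 - t turns the weight with exponent p into
    the one for which P is orthogonal.  Thus P is orthogonal to P - P(1) q for
    the weight with exponent p, and the claim is Pythagoras' inequality. *)
Lemma jacobi_extremal (p r : R) (j : nat) (P q : {poly R}) : 0 < p -> 0 < r ->
  is_jacobi (p + 1) r j P -> (size q <= j.+1)%N -> q.[1] = 1 ->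
  \int[mu]_(t in `[-1, 1]) (P.[t] ^+ 2 * jacobi_weight p r t) <=
  P.[1] ^+ 2 * \int[mu]_(t in `[-1, 1]) (q.[t] ^+ 2 * jacobi_weight p r t).
Proof.
move=> p0 r0 [sP orth _] sq q1.
pose c := P.[1]; pose d := P - c *: q.
have : root d 1 by rewrite /root /d !hornerE q1 mulr1 subrr.
move=> /factor_theorem[u dE].
have su : (size u <= j)%N.
  have sd : (size d <= j.+1)%N.
    rewrite (leq_trans (size_polyD _ _)) // geq_max sP leqnn size_polyN.
    exact: leq_trans (size_scale_leq _ _) _.
  have [->|u0] := eqVneq u 0; first by rewrite size_poly0.
  by move: sd; rewrite dE size_Mmonic ?monicXsubC // size_XsubC addn2.
have cw : {within `[-1, 1], continuous (jacobi_weight p r)} by exact: jacobi_weight_continuous.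
have ch (f : {poly R}) : {within `[-1, 1], continuous (fun t => f.[t])}.
  exact: within_continuous_horner.
have icont (f g : {poly R}) :
    mu.-integrable `[-1, 1] (EFin \o (fun t => f.[t] * g.[t] * jacobi_weight p r t)).
  apply: itv_continuous_integrable; apply: within_continuousM cw.
  exact: within_continuousM.
(* This is the orthogonality of P to - u, as d = - (1 - t) u. *)
have Pd0 : \int[mu]_(t in `[-1, 1]) (P.[t] * d.[t] * jacobi_weight p r t) = 0.
  rewrite -(orth (- u)) ?size_polyN //; apply: eq_Rintegral => t.
  rewrite inE /= in_itv /= => /andP[_ t1].
  rewrite dE /jacobi_weight -(@mulr_powRB1 _ (1 - t) (p + 1)) ?subr_ge0 //; last by lra.
  by rewrite addrK hornerM hornerN hornerXsubC; ring.
rewrite -RintegralZl //; last exact: (icont q q).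
(* The added term has integral 0 and completes the square d^2 below. *)
have -> : \int[mu]_(t in `[-1, 1]) (P.[t] ^+ 2 * jacobi_weight p r t) =
    \int[mu]_(t in `[-1, 1]) (P.[t] * P.[t] * jacobi_weight p r t +
      (- 2) * (P.[t] * d.[t] * jacobi_weight p r t)).
  rewrite RintegralD //; last first.
    apply: itv_continuous_integrable.
    apply: within_continuousM; first exact: within_continuous_cst.
    by apply: within_continuousM cw; exact: within_continuousM.
  by rewrite RintegralZl // Pd0 mulr0 addr0.
apply: le_itv_Rintegral.
- apply: within_continuousD.
    by apply: within_continuousM cw; exact: within_continuousM.
  apply: within_continuousM; first exact: within_continuous_cst.
  by apply: within_continuousM cw; exact: within_continuousM.
- apply: within_continuousM; first exact: within_continuous_cst.
  by apply: within_continuousM cw; exact: within_continuousM.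
move=> t _; have := jacobi_weight_ge0 p r t.
set w := jacobi_weight _ _ _ => w0.
have dt : d.[t] = P.[t] - c * q.[t] by rewrite /d !hornerE.
rewrite -/c -subr_ge0.
have -> : c ^+ 2 * (q.[t] ^+ 2 * w) - (P.[t] * P.[t] * w + -2 * (P.[t] * d.[t] * w))
  = d.[t] ^+ 2 * w by rewrite dt; ring.
by rewrite mulr_ge0 ?sqr_ge0.
Qed.

(** The factor (j + 1)^(2 (p + 1)) from the squared value at 1 cancels against
    the Christoffel bound, up to a square root. *)
Lemma jacobi_sq_integral_le (p r : R) (P : nat -> {poly R}) : 0 < p -> 0 < r ->
  (forall j, is_jacobi (p + 1) r j (P j)) ->
  exists2 C : R, 0 <= C & forall j,
    \int[mu]_(t in `[-1, 1]) ((P j).[t] ^+ 2 * jacobi_weight p r t) <=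
    C * j.+1%:R `^ 2^-1.
Proof.
move=> p0 r0 hP.
have p1 : 1 < p + 1 by lra.
have [C1 C10 P1] := Gamma_quotient_le p1.
have [C2 C20 hq] := small_christoffel_polynomial p0 r0.
exists (C1 ^+ 2 * C2); first by rewrite mulr_ge0 ?sqr_ge0.
move=> j; have [q [sq q1 iq]] := hq j.
apply: le_trans (jacobi_extremal p0 r0 (hP j) sq q1) _.
have P1j : (P j).[1] ^+ 2 <= C1 ^+ 2 * j.+1%:R `^ (2 * (p + 1)).
  have [_ _ E] := hP j.
  have -> : j.+1%:R `^ (2 * (p + 1)) = (j.+1%:R `^ (p + 1)) ^+ 2.
    by rewrite mulrC powRrM powR_mulrn // powR_ge0.
  rewrite -exprMn -real_normK ?num_real // lerXn2r ?nnegrE ?mulr_ge0 ?powR_ge0 //.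
  by rewrite E; exact: P1.
have i0 : 0 <= \int[mu]_(t in `[-1, 1]) (q.[t] ^+ 2 * jacobi_weight p r t).
  by apply: Rintegral_ge0 => t _; rewrite mulr_ge0 ?sqr_ge0 ?jacobi_weight_ge0.
apply: le_trans (ler_pM (sqr_ge0 _) i0 P1j iq) _.
rewrite mulrACA ler_wpM2l ?mulr_ge0 ?sqr_ge0 //.
rewrite -powRD; last by rewrite pnatr_eq0 implybT.
by rewrite [leLHS](_ : _ = j.+1%:R `^ 2^-1) //; congr (_ `^ _); ring.
Qed.

End JacobiNorms.

(** * Uniform cells and their images *)

Section Cells.
Context {R : realType}.
Local Notation mu := (@lebesgue_measure R).

Lemma heine_cantor_within (A : set R) (h : R -> R) (e : R) : compact A ->
  {within A, continuous h} -> 0 < e ->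
  exists2 d : R, 0 < d &
    forall x y, A x -> A y -> `|x - y| < d -> `|h x - h y| < e.
Proof.
move=> cA ch e0.
have := cA => /compact_near_coveringP/(_ R 0^'+
  (fun d x => A x -> forall y, A y -> `|x - y| < d -> `|h x - h y| < e)).
case.
  move=> x Ax.
  have /subspace_continuousP/(_ x Ax)/cvgrPdist_lt/(_ (e / 2)) := ch.
  rewrite divr_gt0 // => /(_ isT).
  rewrite -nbhs_nearE /within => /nbhs_ballP[r /= r0 xr].
  exists (ball x (r / 2), [set d | 0 < d < r / 2]) => /=.
    split; first by apply: nbhsx_ballx; rewrite divr_gt0.
    near=> d; apply/andP; split; near: d; first exact: nbhs_right_gt.
    by apply: nbhs_right_lt; rewrite divr_gt0.
  move=> [z d] /= [xz /andP[d0 dr]] Az y Ay zy.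
  move: xz; rewrite /ball /= => xz.
  have hz : `|h x - h z| < e / 2.
    by apply: xr => //; rewrite /ball /=; apply: lt_le_trans xz _; lra.
  have hy : `|h x - h y| < e / 2.
    apply: xr => //; rewrite /ball /= -(subrK z x) -addrA.
    by apply: le_lt_trans (ler_normD _ _) _; lra.
  rewrite -(subrK (h x) (h z)) -addrA; apply: le_lt_trans (ler_normD _ _) _.
  by rewrite distrC; lra.
move=> d /= d0 H; exists (d / 2); first by rewrite divr_gt0.
move=> x y Ax Ay xy; apply: (H (d / 2)) => //=; last by rewrite divr_gt0.
by rewrite sub0r normrN gtr0_norm ?divr_gt0 //; lra.
Unshelve. all: by end_near. Qed.

Definition node (N i : nat) : R := -1 + 2 * i%:R / N%:R.

Lemma node_bounds N i : (i <= N)%N -> -1 <= node N i <= 1.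
Proof.
case: N => [|N] iN.
  move: iN; rewrite leqn0 => /eqP ->.
  by rewrite /node mulr0 mul0r addr0 lexx /=; lra.
have N0 : 0 < N.+1%:R :> R by rewrite ltr0n.
have h1 : i%:R / N.+1%:R <= 1 :> R by rewrite ler_pdivrMr // mul1r ler_nat.
have h2 : 0 <= i%:R / N.+1%:R :> R by rewrite divr_ge0.
by rewrite /node -mulrA; move: (_ / _) h1 h2 => x h1 h2; lra.
Qed.

Lemma node_step N i : node N i.+1 - node N i = 2 / N%:R.
Proof. by rewrite /node -[i.+1%:R]natr1; ring. Qed.

Lemma node_le N i j : (i <= j)%N -> node N i <= node N j.
Proof.
move=> ij; rewrite /node lerD2l -!mulrA ler_wpM2l // ler_wpM2r ?invr_ge0 //.
by rewrite ler_nat.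
Qed.

(** The half-open cells are disjoint and each has length 2 / N. *)
Lemma count_cells_le (N : nat) (E : set R) (B : {set 'I_N}) : (0 < N)%N ->
  measurable E ->
  (forall i : 'I_N, i \in B -> `[node N i, node N i.+1[ `<=` E) ->
  ((#|B|%:R * (2 / N%:R))%:E <= mu E)%E.
Proof.
move=> N0 mE BE.
pose F (i : 'I_N) : set R := `[node N i, node N i.+1[%classic.
have tF : trivIset (fun i => i \in B) F.
  move=> i j _ _ [x [xi xj]].
  have /andP[xi1 xi2] : node N i <= x < node N i.+1 by move: xi; rewrite /F /= in_itv.
  have /andP[xj1 xj2] : node N j <= x < node N j.+1 by move: xj; rewrite /F /= in_itv.
  apply: val_inj; apply/eqP; rewrite eqn_leq.
  apply/andP; split; rewrite -ltnS ltnNge; apply/negP => /(node_le N).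
    by lra.
  by lra.
have mF i : measurable (F i) by exact: measurable_itv.
have := @measure_bigsetU_ord_cond _ _ _ mu N (fun i => i \in B) F (fun i _ => mF i) tF.
have -> : (\sum_(i < N | i \in B) mu (F i) = (#|B|%:R * (2 / N%:R))%:E)%E.
  transitivity ((\sum_(i < N | i \in B) 2 / N%:R)%:E : \bar R).
    rewrite -sumEFin; apply: eq_bigr => i _.
    rewrite /F lebesgue_measure_itv /= lte_fin -EFinD node_step.
    by rewrite -subr_gt0 node_step divr_gt0 ?ltr0n.
  by rewrite (mulr_natl _ #|B|) -sumr_const.
move=> <-; apply: le_measure; rewrite ?inE //.
  by apply: bigsetU_measurable => i _; exact: mF.
by elim/big_ind: _ => //= A1 A2 h1 h2 x [/h1|/h2].
Qed.

(** The level sets E n of the points with h <= 1 / (n + 1) decrease to a null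
    set, so one of them has measure less than eta.  By uniform continuity, a
    cell of a fine mesh on which h takes a value at most half of 1 / (n + 1)
    lies inside E n. *)
Lemma few_small_cells (h : R -> R) (eta : R) :
  {within `[-1, 1], continuous h} ->
  {ae mu, forall t, t \in `[-1, 1] -> 0 < h t} -> 0 < eta ->
  exists2 kappa : R, 0 < kappa &
    \forall N \near \oo, forall B : {set 'I_N},
      (forall i : 'I_N, i \in B ->
         exists2 t, node N i <= t <= node N i.+1 & h t <= kappa) ->
      #|B|%:R <= eta * N%:R.
Proof.
move=> ch h0 eta0.
pose I : set R := `[-1, 1]%classic.
have mI : measurable I by exact: measurable_itv.
have mh : measurable_fun I h by exact: subspace_continuous_measurable_fun.
pose E (n : nat) : set R := I `&` h @^-1` `]-oo, n.+1%:R^-1].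
have mE n : measurable (E n) by apply: mh => //; exact: measurable_itv.
have mu0 : mu (\bigcap_n E n) = 0%E.
  apply/negligibleP; first exact: bigcapT_measurable.
  apply: negligibleS h0 => t Et /= /(_ _)H.
  have It : t \in `[-1, 1] by have [] := Et 0%N Logic.I.
  have ht := H It.
  have [n hn] : exists n : nat, n.+1%:R^-1 < h t.
    exists (Num.bound (h t)^-1).
    rewrite invf_plt ?posrE ?ltr0n //.
    apply: lt_trans (archi_boundP _) _; first by rewrite invr_ge0 ltW.
    by rewrite ltr_nat.
  have [_ /=] := Et n Logic.I.
  by rewrite in_itv /= leNgt hn.
have cE : mu \o E @ \oo --> mu (\bigcap_n E n).
  apply: nonincreasing_cvg_mu => //.
  - apply: (@le_lt_trans _ _ (mu I)); first by apply: le_measure;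
      [rewrite inE; exact: mE|rewrite inE; exact: mI|exact: subIsetl].
    by rewrite /I lebesgue_measure_itv /= lte_fin; case: ifP => _; rewrite ?ltry // -EFinD ltry.
  - exact: bigcapT_measurable.
  - move=> m n mn; apply/subsetPset => t [It] /=; rewrite in_itv /= => htn.
    split=> //=; rewrite in_itv /=; apply: le_trans htn _.
    by rewrite lef_pV2 ?posrE ?ltr0n // ler_nat.
rewrite mu0 in cE.
have [n En] : exists n, (mu (E n) < eta%:E)%E.
  have /fine_cvgP[fE /cvgrPdist_lt/(_ _ eta0) lE] := cE.
  have [n [fn ln]] := filter_ex (filterI fE lE).
  exists n; rewrite /= in fn; rewrite -(fineK fn) lte_fin.
  by move: ln; rewrite /= sub0r normrN; apply: le_lt_trans; exact: ler_norm.
have c0 : 0 < n.+1%:R^-1 / 2 :> R by rewrite divr_gt0.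
exists (n.+1%:R^-1 / 2) => //.
have [d d0 hd] := heine_cantor_within (@segment_compact _ _ _) ch c0.
near=> N => B HB.
have N0 : (0 < N)%N by near: N; exact: nbhs_infty_gt.
have NR0 : 0 < N%:R :> R by rewrite ltr0n.
have Nd : 2 / N%:R < d.
  rewrite ltr_pdivrMr // mulrC -ltr_pdivrMr //.
  by near: N; exact: nbhs_infty_gtr.
have := @count_cells_le N (E n) B N0 (mE n).
have HE : forall i : 'I_N, i \in B -> `[node N i, node N i.+1[ `<=` E n.
  move=> i /HB[t /andP[t1 t2] ht] s /=; rewrite in_itv /= => /andP[s1 s2].
  have /andP[b1 _] := node_bounds (ltnW (ltn_ord i)).
  have /andP[_ b2] := node_bounds (ltn_ord i).
  have st := node_step N i.
  have Is : I s by rewrite /I /= in_itv /=; apply/andP; split; lra.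
  have It : I t by rewrite /I /= in_itv /=; apply/andP; split; lra.
  split=> //=; rewrite in_itv /=.
  have : `|h s - h t| < n.+1%:R^-1 / 2.
    by apply: hd => //; rewrite ltr_norml; apply/andP; split; lra.
  by rewrite ltr_norml => /andP[_]; move: ht; move: (n.+1%:R^-1) => c; lra.
move=> /(_ HE) /le_lt_trans /(_ En).
rewrite lte_fin mulrA ltr_pdivrMr // => hlt.
have : 0 <= #|B|%:R :> R by [].
lra.
Unshelve. all: by end_near. Qed.

End Cells.

Section Mesh.
Context {R : realType}.
Local Notation mu := (@lebesgue_measure R).

Lemma ae_itv_ex (a b : R) (P : R -> Prop) : a < b -> {ae mu, forall t, P t} ->
  exists2 t, a < t < b & P t.
Proof.
move=> ab aeP; apply: contrapT => nP.
have : mu.-negligible `]a, b[.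
  apply: negligibleS aeP => t /=; rewrite in_itv /= => tab Pt.
  by apply: nP; exists t.
move=> neg; have : mu `]a, b[ = 0%E by apply/negligibleP => //; exact: measurable_itv.
move/eqP; rewrite lebesgue_measure_itv /= lte_fin ab -EFinB eqe subr_eq0.
by rewrite gt_eqF.
Qed.

Lemma within_continuous_lt_nbhs (f : R -> R) (a b t e : R) : a < t < b ->
  {within `[a, b], continuous f} -> 0 < e ->
  exists2 d : R, 0 < d & forall s, `|s - t| < d ->
    a < s < b /\ `|f s - f t| < e.
Proof.
move=> /andP[at1 tb] cf e0.
have tI : `]a, b[%classic t by rewrite /= in_itv /= at1.
have cft : {for t, continuous f}.
  move: cf => /(continuous_within_itvP _ (lt_trans at1 tb))[+ _ _].
  by apply; rewrite inE.
have : \forall s \near t, `|f s - f t| < e.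
  by move: cft => /cvgrPdist_lt/(_ e e0); apply: filterS => s; rewrite distrC.
have : \forall s \near t, a < s < b.
  by have := near_in_itvoo tI; apply: filterS => s; rewrite in_itv.
move=> n1 n2.
have : \forall s \near t, a < s < b /\ `|f s - f t| < e by exact: filterI.
rewrite -nbhs_nearE => /nbhs_ballP[d /= d0 H].
by exists d => // s sd; apply: H; rewrite /ball /= distrC.
Qed.

(** A negative value would persist on an interval, which meets every set of full
    measure. *)
Lemma ae_gt0_ge0 (f : R -> R) (a b t : R) :
  {within `[a, b], continuous f} ->
  {ae mu, forall s, s \in `[a, b] -> 0 < f s} -> a < t < b -> 0 <= f t.
Proof.
move=> cf f0 tab; rewrite leNgt; apply/negP => ft0.
have nft : 0 < - f t by rewrite oppr_gt0.
have [d d0 H] := within_continuous_lt_nbhs tab cf nft.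
have [|s /andP[s1 s2] Ps] := @ae_itv_ex t (t + d) _ _ f0; first by rewrite ltrDl.
have [|/andP[as1 sb]] := H s; first by rewrite ltr_norml; apply/andP; split; lra.
rewrite ltr_norml => /andP[_ h].
have : 0 < f s by apply: Ps; rewrite in_itv /= !ltW.
by lra.
Qed.

(** Outside B, the function min (g', 1 + t) exceeds some k on the whole cell.
    The mean value theorem then bounds the length of the image from below, and
    the left end of the cell is at least -1 + k, so its image is at least
    c = g (-1 + min k 1).  This c is larger than -1 because g' > 0 at some point of
    every interval. *)
Lemma mesh_regular (g : R -> R) : C1_itv (-1) 1 g -> g (-1) = -1 ->
  {ae mu, forall t, t \in `[-1, 1] -> 0 < derive1 g t} ->
  {in `[-1, 1] &, {homo g : x y / x <= y}} /\
  forall eta : R, 0 < eta -> exists (kappa c : R),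
    [/\ 0 < kappa, -1 < c &
    \forall N \near \oo, exists B : {set 'I_N}, #|B|%:R <= eta * N%:R /\
      forall i : 'I_N, i \notin B ->
        kappa * N%:R^-1 <= g (node N i.+1) - g (node N i) /\ c <= g (node N i)].
Proof.
move=> [dgf [dg [cdg gdg]]] gl aeg.
have cg := derivable_oo_LRcontinuous_within dgf.
have [gd _ _] := dgf.
have aeN1 : {ae mu, forall t : R, t != -1}.
  have : mu.-negligible [set (-1 : R)].
    by apply/negligibleP => //; exact: lebesgue_measure_set1.
  by apply: negligibleS => t /= /negP; rewrite negbK => /eqP.
have ae1 : {ae mu, forall t : R, t != 1}.
  have : mu.-negligible [set (1 : R)].
    by apply/negligibleP => //; exact: lebesgue_measure_set1.
  by apply: negligibleS => t /= /negP; rewrite negbK => /eqP.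
have aedg : {ae mu, forall t, t \in `[-1, 1] -> 0 < dg t}.
  move: aeg aeN1 ae1; apply: (@filterS3 _ _ (ae_filter_ringOfSetsType mu)) => t H tN1 t1 tI.
  rewrite -gdg; first exact: H.
  by move: tI; rewrite !in_itv /= => /andP[h1 h2]; rewrite !lt_neqAle h1 h2 t1 eq_sym tN1.
have isd (x : R) : x \in `]-1, 1[ -> is_derive x 1 g (dg x).
  by move=> xI; split; [exact: gd|rewrite -derive1E gdg].
have dg0 (x : R) : x \in `]-1, 1[ -> 0 <= dg x.
  by rewrite in_itv /= => xI; exact: ae_gt0_ge0 cdg aedg xI.
have mvt (x y : R) : -1 <= x -> x < y -> y <= 1 ->
    exists2 z, x < z < y & g y - g x = dg z * (y - x).
  move=> x1 xy y1.
  have isd' z : z \in `]x, y[ -> is_derive z 1 g (dg z).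
    rewrite in_itv /= => /andP[z1 z2]; apply: isd; rewrite in_itv /=.
    by apply/andP; split; lra.
  have cg' : {within `[x, y], continuous g}.
    apply: continuous_subspaceW cg => z /=; rewrite !in_itv /= => /andP[z1 z2].
    by apply/andP; split; lra.
  have [z zI ->] := MVT xy isd' cg'.
  by move: zI; rewrite in_itv /= => zI; exists z.
have gle : {in `[-1, 1] &, {homo g : x y / x <= y}}.
  move=> x y; rewrite !in_itv /= => /andP[x1 _] /andP[_ y1].
  rewrite le_eqVlt => /predU1P[->//|xy].
  have [z /andP[z1 z2] E] := mvt x y x1 xy y1.
  rewrite -subr_ge0 E mulr_ge0 ?subr_ge0 ?(ltW xy) // dg0 // in_itv /=.
  by apply/andP; split; lra.
have gle' (x y : R) : -1 <= x -> x <= y -> y <= 1 -> g x <= g y.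
  move=> x1 xy y1; apply: gle => //; rewrite in_itv /=; apply/andP; split=> //.
    exact: le_trans y1.
  exact: le_trans xy.
split=> // eta eta0.
pose h (t : R) := Num.min (dg t) (1 + t).
have ch : {within `[-1, 1], continuous h}.
  move=> t; apply: continuous_min; first exact: cdg.
  apply: within_continuousD; first exact: within_continuous_cst.
  by apply: continuous_subspaceT => x; exact: cvg_id.
have aeh : {ae mu, forall t, t \in `[-1, 1] -> 0 < h t}.
  move: aedg aeN1; apply: (@filterS2 _ _ (ae_filter_ringOfSetsType mu)) => t H tN1 tI; rewrite /h lt_min H //=.
  by move: tI; rewrite in_itv /= => /andP[h1 _]; rewrite addrC -(opprK 1) subr_gt0 lt_neqAle eq_sym tN1.
have [k k0 Hk] := few_small_cells ch aeh eta0.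
pose k1 := Num.min k 1.
have k10 : 0 < k1 by rewrite lt_min k0 ltr01.
have k1k : k1 <= k by rewrite ge_min lexx.
have k11 : k1 <= 1 by rewrite ge_min lexx orbT.
exists k, (g (-1 + k1)); split=> //.
  have [|t /andP[t1 t2] Pt] := @ae_itv_ex (-1) (-1 + k1) _ _ aedg; first by rewrite ltrDl.
  have dgt : 0 < dg t by apply: Pt; rewrite in_itv /=; apply/andP; split; lra.
  have tI : -1 < t < -1 + k1 by apply/andP; split.
  have cdg' : {within `[-1, -1 + k1], continuous dg}.
    apply: continuous_subspaceW cdg => z /=; rewrite !in_itv /= => /andP[z1 z2].
    by apply/andP; split; lra.
  have [d d0 Hd] := within_continuous_lt_nbhs tI cdg' dgt.
  have d20 : 0 < d / 2 by rewrite divr_gt0.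
  have [|/andP[s1 s2] _] := Hd (t + d / 2).
    by rewrite addrAC subrr add0r gtr0_norm //; lra.
  have [t1' ts s1'] : [/\ -1 <= t, t < t + d / 2 & t + d / 2 <= 1] by split; lra.
  have [z /andP[z1 z2] E] := mvt _ _ t1' ts s1'.
  have [|_] := Hd z; first by rewrite ltr_norml; apply/andP; split; lra.
  rewrite ltr_norml => /andP[dgz _].
  have dgz0 : 0 < dg z by lra.
  have gts : g t < g (t + d / 2) by rewrite -subr_gt0 E mulr_gt0 ?subr_gt0.
  have t1'' : t <= 1 by exact: ltW (lt_le_trans ts s1').
  have k1l : -1 + k1 <= 1 by lra.
  have glt : g (-1) <= g t by exact: gle'.
  have gsk : g (t + d / 2) <= g (-1 + k1).
    by apply: gle' => //; [exact: le_trans t1' (ltW ts)|exact: ltW].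
  by rewrite gl in glt; exact: le_lt_trans glt (lt_le_trans gts gsk).
near=> N.
have N0 : (0 < N)%N by near: N; exact: nbhs_infty_gt.
have NR0 : 0 < N%:R :> R by rewrite ltr0n.
pose bad (i : 'I_N) := `[< exists2 t, node N i <= t <= node N i.+1 & h t <= k >].
exists [set i | bad i]%SET; split.
  have HN : forall B : {set 'I_N},
      (forall i : 'I_N, i \in B ->
         exists2 t, node N i <= t <= node N i.+1 & h t <= k) ->
      #|B|%:R <= eta * N%:R by near: N.
  by apply: HN => i; rewrite inE => /asboolP.
move=> i; rewrite inE => /asboolP nb.
have hk t : node N i <= t <= node N i.+1 -> k < h t.
  by move=> tI; rewrite ltNge; apply/negP => ht; apply: nb; exists t.
have /andP[b1 b1'] := node_bounds (R := R) (ltnW (ltn_ord i)).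
have /andP[b2' b2] := node_bounds (R := R) (ltn_ord i).
have st := node_step (R := R) N i.
have st0 : 0 < 2 / N%:R :> R by rewrite divr_gt0.
have st' : node N i < node N i.+1 :> R by rewrite -subr_gt0 st.
split.
  have [z /andP[z1 z2] ->] := mvt _ _ b1 st' b2.
  have /hk : node N i <= z <= node N i.+1 by rewrite !ltW.
  rewrite lt_min => /andP[kz _].
  rewrite st mulrA ler_pM2r ?invr_gt0 //.
  by apply: le_trans (ltW kz) _; rewrite mulrC mulr_natl mulr2n lerDl (le_trans _ (ltW kz)) ?ltW.
have /hk : node N i <= (node N i : R) <= node N i.+1 by rewrite lexx ltW.
rewrite lt_min => /andP[_ kz].
apply: gle' => //; first by rewrite lerDl ltW.
by rewrite -lerBrDl opprK addrC (le_trans k1k (ltW kz)).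
Unshelve. all: by end_near. Qed.

End Mesh.

(** * Row norms of the histopolation matrix *)

Section HistopolationRow.
Context {R : realType}.
Local Notation mu := (@lebesgue_measure R).

(** The squared weight is dominated by the weight of the extremal problem, which
    has the exponent b + 1 at -1; the quotient is bounded away from -1. *)
Lemma jacobi_weight_sq_le (a b c t : R) : 0 < a -> 0 < b -> -1 < c ->
  c <= t <= 1 ->
  jacobi_weight a b t ^+ 2 <=
  2 `^ a * 2 `^ b / (1 + c) * jacobi_weight a (b + 1) t.
Proof.
move=> a0 b0 c1 /andP[ct t1]; set w := jacobi_weight a b t.
have w0 : 0 <= w by exact: jacobi_weight_ge0.
have t0 : 0 < 1 + t by lra.
have c0 : 0 < 1 + c by lra.
have -> : jacobi_weight a (b + 1) t = w * (1 + t).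
  by rewrite /w /jacobi_weight -mulrA -(@mulr_powRB1 _ (1 + t) (b + 1)) ?addrK 1?[_ * (1 + t)]mulrC //; lra.
have wle : w <= 2 `^ a * 2 `^ b.
  by rewrite ler_pM ?powR_ge0 // ge0_ler_powR ?nnegrE ?(ltW a0) ?(ltW b0) //; lra.
have -> : 2 `^ a * 2 `^ b / (1 + c) * (w * (1 + t)) =
  w * (2 `^ a * 2 `^ b) * ((1 + t) / (1 + c)) by ring.
apply: (@le_trans _ _ (w * (2 `^ a * 2 `^ b))).
  by rewrite expr2 ler_wpM2l.
rewrite ler_peMr ?mulr_ge0 ?powR_ge0 //.
by rewrite ler_pdivlMr // mul1r; lra.
Qed.

Lemma histopolation_row_sq_le (a b c k : R) (p : {poly R}) (x0 x1 : R) :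
  0 < a -> 0 < b -> -1 < c -> 0 < k -> c <= x0 -> x1 <= 1 -> k <= x1 - x0 ->
  ((x1 - x0)^-1 * \int[mu]_(t in `[x0, x1]) (p.[t] * jacobi_weight a b t)) ^+ 2 <=
  k^-1 * (2 `^ a * 2 `^ b / (1 + c)) *
  \int[mu]_(t in `[x0, x1]) (p.[t] ^+ 2 * jacobi_weight a (b + 1) t).
Proof.
move=> a0 b0 c1 k0 cx0 x11 kx; have d0 : 0 < x1 - x0 by exact: lt_le_trans kx.
have xx : x0 < x1 by rewrite -subr_gt0.
have sub : `[x0, x1] `<=` (`[-1, 1] : set R).
  by move=> t /=; rewrite !in_itv /= => /andP[h1 h2]; apply/andP; split; lra.
have b10 : 0 < b + 1 by lra.
have cw := continuous_subspaceW sub (jacobi_weight_continuous a0 b0).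
have cw' := continuous_subspaceW sub (jacobi_weight_continuous a0 b10).
have cp := @within_continuous_horner R `[x0, x1] p.
have cpw := within_continuousM cp cw.
set K := _ / (1 + c); have K0 : 0 <= K.
  by rewrite divr_ge0 ?mulr_ge0 ?powR_ge0 //; lra.
have cpw' : {within `[x0, x1], continuous (fun t => p.[t] ^+ 2 * jacobi_weight a (b + 1) t)}.
  by apply: within_continuousM cw'; exact: within_continuousM.
have h2 : \int[mu]_(t in `[x0, x1]) ((p.[t] * jacobi_weight a b t) ^+ 2) <=
    K * \int[mu]_(t in `[x0, x1]) (p.[t] ^+ 2 * jacobi_weight a (b + 1) t).
  rewrite -RintegralZl //; last exact: itv_continuous_integrable.
  apply: le_itv_Rintegral; first exact: within_continuousM.
    by apply: within_continuousM cpw'; exact: within_continuous_cst.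
  move=> t /andP[t1 t2]; rewrite exprMn [leRHS]mulrCA ler_wpM2l ?sqr_ge0 //.
  by apply: jacobi_weight_sq_le => //; apply/andP; split; lra.
rewrite exprMn exprVn.
apply: (@le_trans _ _ ((x1 - x0) ^- 2 * ((x1 - x0) * (K *
   \int[mu]_(t in `[x0, x1]) (p.[t] ^+ 2 * jacobi_weight a (b + 1) t))))).
  rewrite ler_wpM2l ?invr_ge0 ?sqr_ge0 //.
  apply: le_trans (sqr_Rintegral_le xx cpw) _.
  by rewrite ler_wpM2l ?(ltW d0).
set I := \int[mu]_(t in _) _.
have I0 : 0 <= I.
  by apply: Rintegral_ge0 => t _; rewrite mulr_ge0 ?sqr_ge0 ?jacobi_weight_ge0.
have -> : (x1 - x0) ^- 2 * ((x1 - x0) * (K * I)) = (x1 - x0)^-1 * (K * I).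
  by field; rewrite gt_eqF.
by rewrite -(mulrA k^-1) ler_wpM2r ?(mulr_ge0 K0 I0) // lef_pV2 ?posrE.
Qed.

End HistopolationRow.

Section HistopolationRows.
Context {R : realType}.
Local Notation mu := (@lebesgue_measure R).

(** A kept row carries at most a constant over N times the integrals of
    P_j^2 w over its own segment.  Once all the segments are put back, these
    add up to an integral over [-1, 1] for each of the N columns. *)
Lemma histopolation_frobenius_le (alpha beta c kappa C : R) (P : nat -> {poly R})
    (N : nat) (x : nat -> R) (B : {set 'I_N}) :
  0 < alpha -> 0 < beta -> -1 < c -> 0 < kappa -> 0 <= C -> (0 < N)%N ->
  x 0 = -1 -> x N = 1 -> (forall i j, (i <= j <= N)%N -> x i <= x j) ->
  (forall j, \int[mu]_(t in `[-1, 1]) ((P j).[t] ^+ 2 * jacobi_weight alpha (beta + 1) t)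
     <= C * j.+1%:R `^ 2^-1) ->
  (forall i : 'I_N, i \notin B -> kappa * N%:R^-1 <= x i.+1 - x i /\ c <= x i) ->
  \sum_(i in ~: B) \sum_j (N%:R^-1 *: histopolation_mx alpha beta P N x) i j ^+ 2 <=
  kappa^-1 * (2 `^ alpha * 2 `^ beta / (1 + c)) * C * N%:R `^ 2^-1.
Proof.
move=> a0 b0 c1 k0 C0 N0 x0 xN xle intP good.
have NR0 : 0 < N%:R :> R by rewrite ltr0n.
have N1 : N%:R != 0 :> R by rewrite gt_eqF.
have kN : 0 < kappa * N%:R^-1 by rewrite mulr_gt0 ?invr_gt0.
set K := _ / (1 + c).
have K0 : 0 <= K by rewrite divr_ge0 ?mulr_ge0 ?powR_ge0 //; lra.
pose J (i j : nat) := \int[mu]_(t in `[x i, x i.+1])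
  ((P j).[t] ^+ 2 * jacobi_weight alpha (beta + 1) t).
have J0 i j : 0 <= J i j.
  by apply: Rintegral_ge0 => t _; rewrite mulr_ge0 ?sqr_ge0 ?jacobi_weight_ge0.
have sumJ (j : 'I_N) : \sum_(i < N) J i j <= C * N%:R `^ 2^-1.
  (* The nodes are ordered up to index N; freezing them afterwards gives the
     monotone sequence that the sum of integrals asks for. *)
  pose y i := x (minn i N).
  have yE i : (i <= N)%N -> y i = x i by move=> iN; rewrite /y (minn_idPl iN).
  have -> : \sum_(i < N) J i j = \int[mu]_(t in `[-1, 1])
      ((P j).[t] ^+ 2 * jacobi_weight alpha (beta + 1) t).
    have b10 : 0 < beta + 1 by lra.
    have hy : {homo y : i k / (i <= k)%N >-> i <= k}.
      move=> i k ik; apply: xle; rewrite geq_minr andbT leq_min geq_minr andbT.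
      by rewrite (leq_trans _ ik) // geq_minl.
    have cf : {within `[y 0, y N], continuous
        (fun t => (P j).[t] ^+ 2 * jacobi_weight alpha (beta + 1) t)}.
      rewrite !yE // x0 xN.
      apply: within_continuousM; last exact: jacobi_weight_continuous.
      by apply: within_continuousM; exact: within_continuous_horner.
    have := Rintegral_itv_sum hy cf; rewrite !yE // x0 xN => ->.
    by apply: eq_bigr => i _; rewrite !yE // ltnW.
  apply: le_trans (intP j) _; rewrite ler_wpM2l //.
  by rewrite ge0_ler_powR ?nnegrE // ler_nat.
apply: (@le_trans _ _ (\sum_(i in ~: B) \sum_(j < N)
    kappa^-1 * K * N%:R^-1 * J i j)).
  apply: ler_sum => i; rewrite inE => /good[hi ci]; apply: ler_sum => j _.
  have := @histopolation_row_sq_le R alpha beta c _ (P j) (x i) (x i.+1)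
    a0 b0 c1 kN ci _ hi.
  have -> : x i.+1 <= 1 by rewrite -xN xle // ltn_ord leqnn.
  move=> /(_ isT) h; rewrite 2!mxE exprMn.
  apply: le_trans (ler_wpM2l (sqr_ge0 _) h) _.
  rewrite le_eqVlt; apply/orP; left; apply/eqP; rewrite -/K -/(J i j).
  by field; rewrite N1 gt_eqF.
rewrite exchange_big /=.
apply: (@le_trans _ _ (\sum_(j < N) kappa^-1 * K * N%:R^-1 * (C * N%:R `^ 2^-1))).
  apply: ler_sum => j _; rewrite -mulr_sumr ler_wpM2l //.
    by apply: mulr_ge0; [apply: mulr_ge0 => //|]; rewrite invr_ge0 ltW.
  apply: le_trans (sumJ j); rewrite [leRHS](bigID (mem (~: B))) /= lerDl.
  by apply: sumr_ge0 => i _.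
rewrite sumr_const card_ord -[_ *+ N]mulr_natr le_eqVlt; apply/orP; left.
by apply/eqP; field; rewrite N1 gt_eqF.
Qed.

End HistopolationRows.

Theorem theorem4p8 (R : realType) (alpha beta : R) (g : R -> R)
    (P : nat -> {poly R})
    (halpha : 1 / 2 < alpha) (hbeta : 1 / 2 < beta)
    (hgC1 : C1_itv (-1) 1 g) (hgl : g (-1) = -1) (hgr : g 1 = 1)
    (* the derivative at the two endpoints is irrelevant almost everywhere *)
    (hg' : {ae @lebesgue_measure R, forall t, t \in `[-1, 1] -> 0 < derive1 g t})
    (hP : forall j, is_jacobi (alpha + 1) (beta + 1) j (P j)) :
  zero_distributed (fun N : nat =>
    map_mx (real_complex R)
      (N%:R^-1 *: histopolation_mx alpha beta P N
                    (fun i : nat => g (-1 + 2 * i%:R / N%:R)))).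
Proof.
have a0 : 0 < alpha by lra.
have b0 : 0 < beta by lra.
have b10 : 0 < beta + 1 by lra.
have [gle mesh] := mesh_regular hgC1 hgl hg'.
have [C C0 intP] := jacobi_sq_integral_le a0 b10 hP.
apply: zero_distributed_count => e eta e0 eta0.
have eta20 : 0 < eta / 2 by rewrite divr_gt0.
have [k [c [k0 c1 Hmesh]]] := mesh _ eta20.
pose D := e ^- 2 * (k^-1 * (2 `^ alpha * 2 `^ beta / (1 + c)) * C).
have D0 : 0 <= D.
  rewrite !mulr_ge0 ?invr_ge0 ?sqr_ge0 ?powR_ge0 ?(ltW k0) //; lra.
near=> N.
have N0 : (0 < N)%N by near: N; exact: nbhs_infty_gt.
have NR0 : 0 < N%:R :> R by rewrite ltr0n.
have [B [cardB good]] : exists B : {set 'I_N}, #|B|%:R <= eta / 2 * N%:R /\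
  forall i : 'I_N, i \notin B ->
    k * N%:R^-1 <= g (node N i.+1) - g (node N i) /\ c <= g (node N i) by near: N.
apply: le_trans (count_singular_values _ B e0) _.
have DN : D * N%:R `^ 2^-1 <= eta / 2 * N%:R.
  have sN : (2 * D / eta) ^+ 2 <= N%:R by near: N; exact: nbhs_infty_ger.
  rewrite powR12_sqrt ?(ltW NR0) //.
  have s0 : 0 <= Num.sqrt N%:R :> R by exact: sqrtr_ge0.
  rewrite -[in leRHS](sqr_sqrtr (ltW NR0)) expr2 mulrA ler_wpM2r //.
  have : 2 * D / eta <= Num.sqrt N%:R.
    have D2 : 0 <= 2 * D / eta by apply: divr_ge0; [exact: mulr_ge0|exact: ltW].
    rewrite -[leLHS](ger0_norm D2) -sqrtr_sqr.
    by rewrite ler_sqrt ?(ltW NR0).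
  by rewrite ler_pdivrMr // => h; lra.
have := @histopolation_frobenius_le R alpha beta c k C P N (fun i => g (node N i)) B
  a0 b0 c1 k0 C0 N0 _ _ _ intP good.
have n0 : g (node N 0) = -1 by rewrite /node mulr0 mul0r addr0.
have nN : g (node N N) = 1.
  rewrite /node mulfK ?gt_eqF //.
  by have -> : -1 + 2 = 1 :> R by lra.
have nle i j : (i <= j <= N)%N -> g (node N i) <= g (node N j).
  move=> /andP[ij jN]; apply: gle; rewrite ?in_itv /=; [..|exact: node_le].
    by apply: node_bounds; exact: leq_trans jN.
  exact: node_bounds.
move=> /(_ n0 nN nle) h.
apply: (@le_trans _ _ (eta / 2 * N%:R + D * N%:R `^ 2^-1)).
  apply: lerD => //; rewrite /D -mulrA ler_wpM2l ?invr_ge0 ?sqr_ge0 //.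
by rewrite [leRHS](_ : _ = eta / 2 * N%:R + eta / 2 * N%:R) ?lerD2l //; field.
Unshelve. all: by end_near. Qed.
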